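(* Let $d\ge 2$ be a prime and let $\alpha,\beta\in\mathbb{C}$ with $\alpha\neq 0$. Then the complex polynomial function $z\mapsto\alpha(z-\beta)^d+\beta$ has no iterative roots of order $d$ on $\mathbb{C}$.
   Context: An iterative root of order $n$ on $\mathbb{C}$ of a map $f:\mathbb{C}\to\mathbb{C}$ is a map $g:\mathbb{C}\to\mathbb{C}$ (arbitrary, no continuity or other regularity required) with $g^n=f$, where $g^n$ is the $n$-fold composition of $g$ with itself. *)

(* Defs.v *)
From mathcomp Require Import all_boot.

Set Implicit Arguments.
Unset Strict Implicit.
Unset Printing Implicit Defensive.

(* Both maps are arbitrary: no continuity or other regularity is assumed. *)
Definition iterative_root (T : Type) (n : nat) (f g : T -> T) : Prop :=
  iter n g =1 f.

(* Main.v *)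
Require Import Defs.
From mathcomp Require Import all_boot all_order all_algebra.
From mathcomp Require Import separable.
From mathcomp Require Import reals complex.

(** Let [f z = alpha (z - beta)^d + beta] and suppose that [g^d = f]. The
    equation [f^d z = z] has degree [d^d] and only simple roots, and [f z = z]
    has [d] roots, so, [d] being prime, there are [d^d - d] points of exact
    [f]-period [d]. On these points [g^(d^2)] is the identity while [g^d] has
    no fixed point, so all [g]-orbits have [d^2] elements. Hence [d^2] divides
    [d^d - d], and therefore [d]. *)

Set Implicit Arguments.
Unset Strict Implicit.
Unset Printing Implicit Defensive.

Import GRing.Theory Num.Theory.
Local Open Scope ring_scope.
Local Open Scope complex_scope.

Lemma order_dvdn (T : finType) (f : T -> T) (n : nat) (x : T) :
  injective f -> iter n f x = x -> (fingraph.order f x %| n)%N.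
Proof.
move=> f_inj; set o := fingraph.order f x => fnx.
have fox m : iter (m * o) f x = x.
  by elim: m => // m IHm; rewrite mulSn iterD IHm iter_order.
have frx : iter (n %% o) f x = x.
  by rewrite -[RHS]fnx [in RHS](divn_eq n o) addnC iterD fox.
have lt_ro : (n %% o < o)%N by rewrite ltn_mod order_gt0.
(* Below the order, the index of an iterate on the orbit of [x] recovers its exponent; as the
   iterate is [x] itself, the remainder is 0. *)
by rewrite /dvdn -(findex_iter lt_ro) frx findex0.
Qed.

(** The orbits of an injective map partition the finite type, here into blocks of equal size [n]. *)
Lemma dvdn_card_order (T : finType) (f : T -> T) (n : nat) :
  injective f -> (forall x, fingraph.order f x = n) -> (n %| #|T|)%N.
Proof.
move=> f_inj f_order.
rewrite -(@fcard_order_set _ f f_inj n predT) ?dvdn_mull //.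
by apply/subsetP => x _; rewrite inE f_order.
Qed.

(** On [s], every orbit length divides [p ^ 2], so it is a power of [p]; length 1 or [p] would give
    a fixed point of [iter p g]. Hence all orbits have exactly [p ^ 2] elements. *)
Lemma prime_sqr_dvdn_size (T : choiceType) (s : seq T) (g : T -> T) (p : nat) :
    prime p -> uniq s -> {homo g : x / x \in s} ->
    {in s, forall x, iter (p * p) g x = x} ->
    {in s, forall x, iter p g x != x} ->
  (p ^ 2 %| size s)%N.
Proof.
move=> p_pr s_uniq g_s g_period g_nofix.
pose h (x : seq_sub s) := SeqSub (g_s _ (ssvalP x)).
have val_iter n x : ssval (iter n h x) = iter n g (ssval x).
  by elim: n => //= n ->.
have h_period x : iter (p * p) h x = x.
  by apply/val_inj; rewrite /= val_iter g_period // ssvalP.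
have h_inj : injective h.
  have pp_gt0 : (0 < p * p)%N by rewrite muln_gt0 prime_gt0.
  (* The map [iter (p * p).-1 h] is a left inverse of [h]. *)
  move=> x y hxy; rewrite -[x]h_period -[y]h_period.
  by rewrite -(prednK pp_gt0) !iterSr hxy.
rewrite -(card_seq_sub s_uniq); apply: (dvdn_card_order h_inj) => x.
have : (fingraph.order h x %| p ^ 2)%N by rewrite order_dvdn // -mulnn.
case/(dvdn_pfactor _ _ p_pr) => e; rewrite leq_eqVlt => /predU1P[-> // | e_lt2 oE].
have := g_nofix _ (ssvalP x); rewrite -val_iter; case/eqP; congr ssval.
have: (fingraph.order h x %| p)%N.
  by rewrite oE -[X in (_ %| X)%N]expn1 dvdn_exp2l.
case/dvdnP => m ->; elim: m => // m IHm.
by rewrite mulSn iterD IHm iter_order.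
Qed.

(** Up to translation by [b], the fixed points are the roots of [a X^n - X], which are distinct
    because this polynomial shares no root with its derivative [n a X^(n-1) - 1]. *)
Lemma fixed_points_affine_power (F : numClosedFieldType) (a b : F) (n : nat) :
    a != 0 -> (1 < n)%N ->
  exists s : seq F, [/\ uniq s, size s = n &
    forall z, (z \in s) = (a * (z - b) ^+ n + b == z)].
Proof.
move=> a_neq0 n_gt1; pose p : {poly F} := a *: 'X^n - 'X.
have size_aXn : size (a *: 'X^n) = n.+1 by rewrite size_scale // size_polyXn.
have size_p : size p = n.+1.
  by rewrite size_polyDl // size_polyN size_polyX size_aXn.
have [r Dp] := closed_field_poly_normal p.
have lc_neq0 : lead_coef p != 0 by rewrite lead_coef_eq0 -size_poly_eq0 size_p.
have p_sep : separable_poly p.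
  rewrite unlock; apply: Pdiv.ClosedField.root_coprimep => x.
  rewrite /root /p derivB derivX derivZ derivXn !(hornerE, hornerMn) /=.
  rewrite subr_eq0 => /eqP px; apply/negP; rewrite subr_eq0 => /eqP p'x.
  have x0 : x = 0.
    (* Multiply [n a x^(n-1) = 1] by [x] and use [a x^n = x]; characteristic zero and [n > 1] then
       force [x = 0]. *)
    have nx : x *+ n = x.
      rewrite -[in RHS](mulr1 x) -p'x -{1}px -(prednK (ltnW n_gt1)).
      by rewrite /= exprS !mulrnAr mulrCA.
    apply/eqP; have /eqP := nx; rewrite -subr_eq0 -[X in _ - X]mulr1n.
    by rewrite -mulrnBr ?(ltnW n_gt1) // mulrn_eq0 subn_eq0 leqNgt n_gt1.
  (* Writing [n] as [2 + (n - 2)] shows that [n.-1] is positive, so at 0 the derivative equation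
     reads [0 = 1]. *)
  move/eqP: p'x; rewrite x0 -(subnKC n_gt1) /= expr0n /= mul0rn mulr0.
  by rewrite eq_sym oner_eq0.
have r_uniq : uniq r.
  rewrite -separable_prod_XsubC; move: p_sep.
  by rewrite Dp (eqp_separable (eqp_scale _ lc_neq0)).
exists [seq x + b | x <- r]; split.
- by rewrite map_inj_uniq //; apply: addIr.
- rewrite size_map; move/(congr1 (fun q : {poly F} => size q)): Dp.
  by rewrite /= size_scale // size_prod_XsubC size_p => -[].
- move=> z; rewrite -{1}[z](subrK b) (mem_map (@addIr _ b)).
  rewrite -root_prod_XsubC -(rootZ _ _ lc_neq0) -Dp /root !hornerE subr_eq0.
  by rewrite [LHS]eq_sym subr_eq [LHS]eq_sym.
Qed.

(** The iterates keep the shape of the map, so the fixed points of the [d]-th iterate can be counted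
    in the same way as those of the map itself. *)
Lemma iter_affine_power (F : fieldType) (a b : F) (d k : nat) :
    a != 0 ->
  exists2 c : F, c != 0 &
    iter k (fun z => a * (z - b) ^+ d + b) =1
      (fun z => c * (z - b) ^+ (d ^ k) + b).
Proof.
move=> a_neq0; elim: k => [|k [c c_neq0 IHk]].
  by exists 1; rewrite ?oner_neq0 // => z; rewrite expr1 mul1r subrK.
exists (a * c ^+ d) => [|z]; first by rewrite mulf_neq0 ?expf_neq0.
by rewrite iterS IHk addrK exprMn -exprM -expnSr mulrA.
Qed.

Lemma affine_power_no_iterative_root (F : numClosedFieldType) (d : nat)
    (a b : F) (g : F -> F) :
    prime d -> a != 0 ->
  ~ iterative_root d (fun z => a * (z - b) ^+ d + b) g.
Proof.
move=> d_pr a_neq0; set f := (fun z => _) => gf.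
have d_gt1 := prime_gt1 d_pr; have d_gt0 := prime_gt0 d_pr.
have [s1 [s1_uniq size_s1 mem_s1]] := fixed_points_affine_power b a_neq0 d_gt1.
have [c c_neq0 fE] := iter_affine_power b d d a_neq0.
have dd_gt1 : (1 < d ^ d)%N by rewrite -(exp1n d) ltn_exp2r.
have [s2 [s2_uniq size_s2 mem_s2]] := fixed_points_affine_power b c_neq0 dd_gt1.
have {}mem_s1 z : (z \in s1) = (f z == z) by rewrite mem_s1.
have {}mem_s2 z : (z \in s2) = (iter d f z == z) by rewrite mem_s2 fE.
pose s := [seq z <- s2 | z \notin s1].
have mem_s z : (z \in s) = (f z != z) && (iter d f z == z).
  by rewrite mem_filter mem_s1 mem_s2.
have iterf m z : iter m f z = iter (m * d) g z.
  by elim: m => //= m ->; rewrite -gf mulSn iterD.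
(* The sum form avoids truncated subtraction and suits [dvdn_addr] below. *)
have size_s : (size s + d = d ^ d)%N.
  have s12 : {subset s1 <= s2}.
    by move=> z; rewrite mem_s1 mem_s2 => /eqP fz; rewrite iter_fix.
  rewrite -[X in (_ + X)%N]size_s1 -[RHS]size_s2 addnC -(count_predC (mem s1) s2) size_filter.
  congr addn; rewrite -size_filter; apply/perm_size/uniq_perm => //.
    exact: filter_uniq.
  by move=> z; rewrite mem_filter /=; case: (boolP (z \in s1)) => // /s12.
have fg z : f (g z) = g (f z) by rewrite -!gf -iterSr.
have itfg m z : iter m f (g z) = g (iter m f z).
  by elim: m => //= m ->.
have dvd_s : (d ^ 2 %| size s)%N.
  apply: (prime_sqr_dvdn_size (g := g)) => //; first exact: filter_uniq.
  - move=> z; rewrite !mem_s itfg => /andP[fz_neq /eqP fdz].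
    (* If [f] fixes [g z], it fixes all later [g]-iterates of [z], as [f] and [g] commute. One of
       them is [z] itself, since [z = iter d f z = iter (d * d) g z] with [d * d > 0]. *)
    rewrite fdz eqxx andbT; apply: contra fz_neq => /eqP fgz.
    have fit m : f (iter m.+1 g z) = iter m.+1 g z.
      by elim: m => // m IHm; rewrite iterS fg IHm.
    have dd0 : (0 < d * d)%N by rewrite muln_gt0 d_gt0.
    by rewrite -fdz iterf -(prednK dd0) fit.
  - by move=> z; rewrite mem_s -iterf => /andP[_ /eqP].
  - by move=> z; rewrite mem_s gf => /andP[].
(* As [d >= 2], [d ^ 2] divides the total [d ^ d], hence also the other summand [d]. *)
have : (d ^ 2 %| d)%N by rewrite -(dvdn_addr _ dvd_s) size_s dvdn_exp2l.
by move/(dvdn_leq d_gt0); rewrite -mulnn -{3}[d]muln1 leq_pmul2l // leqNgt d_gt1.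
Qed.

Theorem corollary20 (R : realType) (d : nat) (alpha beta : R[i])
    (d_prime : prime d) (alpha_neq0 : alpha != 0) :
  ~ exists g : R[i] -> R[i],
      iterative_root d (fun z : R[i] => alpha * (z - beta) ^+ d + beta) g.
Proof. by case=> g; apply: affine_power_no_iterative_root. Qed.
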